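(* Let $(g,h) \in \mathbb{F}_2[x]\times\mathbb{F}_2[x]$ be a minimal representative. If $(g,h)$ is Type 1, or $(g,h)$ is Type 2 and $\deg g > 0$, then the unit group is trivial: $(\mathbb{F}_2[x,y]/(y^2+gy+h))^\times = \{1\}$.
   Context: The convention $\deg(0) := -\infty$ is used. A pair $(g,h) \in \mathbb{F}_2[x]\times\mathbb{F}_2[x]$ is a minimal representative if $\deg h \le \deg(h+gf+f^2)$ for every $f \in \mathbb{F}_2[x]$. A minimal representative $(g,h)$ is called Type 1 if $2\deg g < \deg h$ and $\deg h$ is odd, and Type 2 if $2\deg g = \deg h$. *)

(* Defs.v *)
From HB Require Import structures.
From mathcomp Require Import all_boot all_order all_algebra.
From mathcomp Require Import constructive_ereal.

Set Implicit Arguments.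
Unset Strict Implicit.
Unset Printing Implicit Defensive.

Import Order.TTheory GRing.Theory Num.Theory.
Local Open Scope ring_scope.

Definition degp (R : nzRingType) (p : {poly R}) : \bar int :=
  if p == 0 then -oo%E else ((size p).-1%:Z)%:E.

Definition minimal_rep (g h : {poly 'F_2}) : Prop :=
  forall f : {poly 'F_2}, (degp h <= degp (h + g * f + f ^+ 2))%E.

Definition type1 (g h : {poly 'F_2}) : Prop :=
  (2%:E * degp g < degp h)%E /\
  (exists2 n : nat, odd n & degp h = (n%:Z)%:E).

Definition type2 (g h : {poly 'F_2}) : Prop :=
  (2%:E * degp g)%E = degp h.

(* The outer variable 'X of {poly {poly 'F_2}} is y; the inner one is x. *)
Definition quad_poly (g h : {poly 'F_2}) : {poly {poly 'F_2}} :=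
  'X^2 + g%:P * 'X + h%:P.

(* {poly %/ p} is the quotient by p only if p is monic and nonconstant; these
   three lemmas show that this is the case for quad_poly g h. *)
Lemma size_quad_poly (g h : {poly 'F_2}) : size (quad_poly g h) = 3%N.
Proof.
rewrite /quad_poly -addrA size_polyDl size_polyXn //.
rewrite (leq_ltn_trans (size_polyD _ _)) // gtn_max.
rewrite (leq_ltn_trans (size_polyC_leq1 _)) // andbT.
rewrite (leq_ltn_trans (size_polyMleq _ _)) // size_polyX addn2 /= ltnS.
by rewrite ltnS size_polyC_leq1.
Qed.

Lemma monic_quad_poly (g h : {poly 'F_2}) : quad_poly g h \is monic.
Proof.
rewrite monicE /lead_coef size_quad_poly /quad_poly /=.
by rewrite !coefD coefXn coefMX !coefC /= !addr0.
Qed.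

Lemma mk_monic_quad_poly (g h : {poly 'F_2}) :
  mk_monic (quad_poly g h) = quad_poly g h.
Proof. by rewrite /mk_monic size_quad_poly monic_quad_poly. Qed.

Definition coord_ring (g h : {poly 'F_2}) : comNzRingType :=
  {poly %/ quad_poly g h}.

(* Membership in the unit group; GRing.unit would require a unitRingType
   structure, which coord_ring g h does not have. *)
Definition is_unit (A : comNzRingType) (u : A) : Prop :=
  exists v : A, u * v = 1.

(* Main.v *)
(** The conjugation [y |-> - g - y] gives the multiplicative norm
    [a + b y |-> a^2 - a b g + b^2 h], so the norm of a unit is a unit of F_2[x],
    of degree 0.  If [b <> 0], the leading terms of the norm do not cancel:
    in Type 1, [a^2] and [b^2 h] have degrees of different parity, and
    [a b g] has degree below their average; in Type 2, the only critical case
    is [deg a = deg b + deg g], where the leading coefficient is a value of the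
    form [s^2 - s t + t^2], which is anisotropic over F_2.
    Hence the norm has degree at least [deg h > 0], so [b = 0] and [a = 1]. *)

Require Import Defs.
From mathcomp Require Import all_boot all_order all_algebra.
From mathcomp Require Import constructive_ereal.
From mathcomp Require Import ring zify.

Import Order.TTheory GRing.Theory Num.Theory.
Local Open Scope ring_scope.

Definition quad_norm (R : comNzRingType) (g h a b : R) : R :=
  a ^+ 2 - a * b * g + b ^+ 2 * h.

(** The last two arguments on the right are the coordinates of [(a + b y) (c + d y)] after
    substituting [y^2 = - g y - h], so this is multiplicativity of the norm. *)
Lemma quad_normM (R : comNzRingType) (g h a b c d : R) :
  quad_norm R g h a b * quad_norm R g h c d =
  quad_norm R g h (a * c - b * d * h) (a * d + b * c - b * d * g).
Proof. by rewrite /quad_norm; ring. Qed.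

Lemma poly_size2E (R : nzRingType) (p : {poly R}) :
  (size p <= 2)%N -> p = (p`_0)%:P + (p`_1)%:P * 'X.
Proof.
move=> sp; apply/polyP => i; rewrite coefD coefMX !coefC.
case: i => [|[|i]] /=; rewrite ?addr0 ?add0r //.
by rewrite nth_default // (leq_trans sp).
Qed.

Lemma size_coord (g h : {poly 'F_2}) (u : coord_ring g h) :
  (size (u : {poly {poly 'F_2}}) <= 2)%N.
Proof.
by rewrite (leq_trans (size_npoly u)) // mk_monic_quad_poly size_quad_poly.
Qed.

Lemma coord_ring_mulE (g h : {poly 'F_2}) (u v : coord_ring g h)
    (p := u : {poly {poly 'F_2}}) (q := v : {poly {poly 'F_2}}) :
  u * v = (p`_0 * q`_0 - p`_1 * q`_1 * h)%:P
    + (p`_0 * q`_1 + p`_1 * q`_0 - p`_1 * q`_1 * g)%:P * 'X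
  :> {poly {poly 'F_2}}.
Proof.
have pE : p = _ := poly_size2E _ p (size_coord _ _ u).
have qE : q = _ := poly_size2E _ q (size_coord _ _ v).
rewrite poly_of_qpolyM -/p -/q; move: p q pE qE => p q pE qE.
rewrite mk_monic_quad_poly.
set a := p`_0 in pE *; set b := p`_1 in pE *.
set c := q`_0 in qE *; set d := q`_1 in qE *.
(* Explicit Euclidean division: the quotient is the [y^2]-coefficient [b * d] of [p * q], and the
   rest has degree at most 1 in [y], so it is the remainder. *)
rewrite (_ : p * q = (b * d)%:P * quad_poly g h +
    ((a * c - b * d * h)%:P + (a * d + b * c - b * d * g)%:P * 'X)); last first.
  by rewrite pE qE /quad_poly !(polyCD, polyCN, polyCM); ring.
rewrite Pdiv.RingMonic.rmodp_addl_mul_small ?monic_quad_poly //.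
rewrite size_quad_poly ltnS (leq_trans (size_polyD _ _)) // geq_max.
rewrite (leq_trans (size_polyC_leq1 _)) //=.
rewrite (leq_trans (size_polyMleq _ _)) // size_polyX addn2 /= ltnS.
exact: size_polyC_leq1.
Qed.

(** The coordinates of [u * v] are 1 and 0, so the norms of [u] and [v] multiply to 1, which forces
    both to be nonzero constants. *)
Lemma coord_ring_unit_norm (g h : {poly 'F_2}) (u v : coord_ring g h)
    (p := u : {poly {poly 'F_2}}) :
  u * v = 1 -> size (quad_norm _ g h p`_0 p`_1) = 1%N.
Proof.
move=> uv1; have := coord_ring_mulE g h u v; rewrite uv1 -/p /=.
set q := (v : {poly {poly 'F_2}}) => E.
have E0 : p`_0 * q`_0 - p`_1 * q`_1 * h = 1.
  have := congr1 (fun r : {poly {poly 'F_2}} => r`_0) E.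
  by rewrite coefD coefMX !coefC /= addr0 => <-.
have E1 : p`_0 * q`_1 + p`_1 * q`_0 - p`_1 * q`_1 * g = 0.
  have := congr1 (fun r : {poly {poly 'F_2}} => r`_1) E.
  by rewrite coefD coefMX !coefC /= add0r => <-.
have := quad_normM _ g h p`_0 p`_1 q`_0 q`_1; rewrite E0 E1.
rewrite /quad_norm !mulr0 expr0n mul0r mul0r subr0 addr0 expr1n.
move/(congr1 (fun r : {poly 'F_2} => size r)); rewrite size_poly1.
by move/eqP; rewrite size_mul_eq1 => /andP[/eqP].
Qed.

(** Sizes exceed degrees by one, so an even [size h] means an odd degree, and for [g != 0] the last
    hypothesis says [2 deg g < deg h]. The larger of [a^2] and [b^2 h] then strictly dominates the
    other two terms. *)
Lemma size_quad_norm_odd (R : idomainType) (g h a b : {poly R}) :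
  b != 0 -> h != 0 -> ~~ odd (size h) -> (2 * size g <= size h)%N ->
  (size h <= size (quad_norm _ g h a b))%N.
Proof.
move=> b0 h0 oddh gh; rewrite /quad_norm.
have sb := b0; rewrite -size_poly_gt0 in sb.
have sh := h0; rewrite -size_poly_gt0 in sh.
have sbh : size (b ^+ 2 * h) = (2 * size b + size h - 2)%N.
  by rewrite expr2 !size_mul ?mulf_neq0 //; lia.
have [->|a0] := eqVneq a 0.
  by rewrite expr2 !mul0r subr0 add0r sbh; lia.
have sa := a0; rewrite -size_poly_gt0 in sa.
have saa : size (a ^+ 2) = (2 * size a - 1)%N.
  by rewrite expr2 size_mul //; lia.
have sab : (size (- (a * b * g)) <= size a + size b + size g - 2)%N.
  have : (size (a * b * g)%R <= (size (a * b)%R + size g).-1)%N.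
    exact: size_polyMleq.
  have -> : size (- (a * b * g))%R = size (a * b * g)%R by exact: size_polyN.
  by rewrite (size_mul a0 b0); lia.
have [lt_ab|lt_ba|eq_ab] := ltngtP (size (a ^+ 2)) (size (b ^+ 2 * h)).
- rewrite addrC size_polyDl sbh; first by lia.
  rewrite (leq_ltn_trans (size_polyD _ _)) // gtn_max -sbh lt_ab.
  by rewrite (leq_ltn_trans sab) // sbh; lia.
- rewrite -addrA size_polyDl saa; first by lia.
  rewrite (leq_ltn_trans (size_polyD _ _)) // gtn_max -saa lt_ba andbT.
  by rewrite (leq_ltn_trans sab) // saa; lia.
(* Equality is impossible: [saa] is odd and [sbh] is even. *)
- by lia.
Qed.

(** In the convolution sum, an index above [i] kills the factor from [p], and one below [i] kills
    the factor from [q]. As [i] and [j] are only degree bounds, terms of smaller degree can be read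
    off at a common index. *)
Lemma coefM_top (R : nzSemiRingType) (p q : {poly R}) (i j : nat) :
  (size p <= i.+1)%N -> (size q <= j.+1)%N ->
  (p * q)`_(i + j) = p`_i * q`_j.
Proof.
move=> sp sq; rewrite coefM.
have lt_i : (i < (i + j).+1)%N by lia.
rewrite (bigD1 (Ordinal lt_i)) //= addKn big1 ?addr0 // => k.
rewrite -val_eqE /= => neq_ki.
have [lt_ik|lt_ki|eq_ik] := ltngtP i k; last by case/eqP: neq_ki.
  by rewrite [p`_k]nth_default ?mul0r ?(leq_trans sp).
by rewrite [q`__]nth_default ?mulr0 // (leq_trans sq) //; lia.
Qed.

Lemma anisotropic_F2 (s t : 'F_2) :
  s ^+ 2 - s * t + t ^+ 2 = 0 -> s = 0 /\ t = 0.
Proof.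
by case: s t => [[|[|s]] // ?] [[|[|t]] // ?] /(congr1 val) //= _;
   split; apply: val_inj.
Qed.

Lemma lead_coef_F2 (p : {poly 'F_2}) : p != 0 -> lead_coef p = 1.
Proof.
rewrite -lead_coef_eq0; case: (lead_coef p) => [[|[|s]] // ?] _.
exact: val_inj.
Qed.

(** The coefficient at [k + k] is the anisotropic form evaluated at [a_k] and [b_l], which are not
    both zero; moreover [2 k >= 2 deg g = deg h]. *)
Lemma size_quad_norm_even (g h a b : {poly 'F_2}) :
  b != 0 -> g != 0 -> size h = (2 * (size g).-1).+1 ->
  (size h <= size (quad_norm _ g h a b))%N.
Proof.
move=> b0 g0 hg; set m := (size g).-1 in hg *.
have h0 : h != 0 by rewrite -size_poly_gt0 hg.
have sb := b0; rewrite -size_poly_gt0 in sb.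
have sg : size g = m.+1 by rewrite /m prednK // size_poly_gt0.
(* The maximum is at least [m], so this truncated subtraction is exact, even for [a = 0]. *)
pose l := (maxn (size a).-1 ((size b).-1 + m) - m)%N.
pose k := (l + m)%N.
have ka : (size a <= k.+1)%N by rewrite /k /l; lia.
have lb : (size b <= l.+1)%N by rewrite /l; lia.
have gm : g`_m = 1 by rewrite -[RHS](lead_coef_F2 g).
have hm : h`_(m + m) = 1.
  by rewrite -[RHS](lead_coef_F2 h) // /lead_coef hg /= mul2n addnn.
(* [k] is the larger of [deg a] and [deg b + deg g], so that [2 k] bounds the
   degree of every term of the norm. *)
have top : (quad_norm _ g h a b)`_(k + k) =
    a`_k ^+ 2 - a`_k * b`_l + b`_l ^+ 2.
  have sbb : (size (b ^+ 2) <= (l + l).+1)%N.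
    by rewrite expr2 (leq_trans (size_polyMleq _ _)); lia.
  have sab : (size (a * b)%R <= (k + l).+1)%N.
    by rewrite (leq_trans (size_polyMleq _ _)); lia.
  rewrite /quad_norm !coefD coefN expr2 coefM_top // -expr2; congr (_ - _ + _).
    by rewrite {2}/k addnA coefM_top ?sg // gm mulr1 coefM_top.
  rewrite (_ : k + k = (l + l) + (m + m))%N; last by rewrite /k; lia.
  rewrite coefM_top ?hm ?mulr1 //; first by rewrite expr2 coefM_top.
  by rewrite hg; lia.
have nz : (quad_norm _ g h a b)`_(k + k) != 0.
  apply/negP => /eqP; rewrite top => /anisotropic_F2 [ak bl].
  (* If [deg b < l], then [k = deg a] and [a_k] is the leading coefficient of [a]; otherwise
     [l = deg b] and [b_l] is that of [b]. *)
  have [lt_l|le_l] := ltnP (size b).-1 l.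
    have a0 : a != 0 by rewrite -size_poly_gt0; rewrite /l in lt_l; lia.
    move: a0; rewrite -lead_coef_eq0 /lead_coef.
    by rewrite (_ : (size a).-1 = k) ?ak ?eqxx // /k /l; rewrite /l in lt_l; lia.
  move: b0; rewrite -lead_coef_eq0 /lead_coef.
  by rewrite (_ : (size b).-1 = l) ?bl ?eqxx //; lia.
rewrite hg (@leq_trans (k + k).+1) //; first by rewrite /k; lia.
by rewrite ltnNge; apply: contraNN nz => /(nth_default 0) ->.
Qed.

Lemma degp_neq0 (p : {poly 'F_2}) :
  p != 0 -> degp p = ((size p).-1%:Z)%:E.
Proof. by rewrite /degp => /negPf ->. Qed.

Lemma double_degp (p : {poly 'F_2}) :
  p != 0 -> (2%:E * degp p)%E = ((2 * (size p).-1)%N%:Z)%:E.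
Proof. by move=> p0; rewrite degp_neq0 // PoszM. Qed.

Lemma degp0 (R : nzRingType) : degp (0 : {poly R}) = -oo%E.
Proof. by rewrite /degp eqxx. Qed.

Lemma size_quad_norm_type1 (g h a b : {poly 'F_2}) :
  type1 g h -> b != 0 -> (1 < size (quad_norm _ g h a b))%N.
Proof.
case=> lt_gh [n odd_n]; have [->|h0] := eqVneq h 0; first by rewrite degp0.
move: lt_gh; rewrite (degp_neq0 h) // => lt_gh hn b0.
have {}hn : (size h).-1 = n by case: hn.
have sh := h0; rewrite -size_poly_gt0 in sh.
have gt1 : (1 < size h)%N by lia.
have even_h : ~~ odd (size h) by lia.
have le_gh : (2 * size g <= size h)%N.
  move: lt_gh; have [->|g0] := eqVneq g 0; first by rewrite size_poly0.
  rewrite double_degp // lte_fin ltz_nat.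
  by rewrite -size_poly_gt0 in g0; clear -g0 sh; lia.
exact/(leq_trans gt1)/size_quad_norm_odd.
Qed.

(** The bound by [size h] excludes constant norms because [deg h = 2 deg g > 0]. *)
Lemma size_quad_norm_type2 (g h a b : {poly 'F_2}) :
  type2 g h -> (0%:E < degp g)%E -> b != 0 ->
  (1 < size (quad_norm _ g h a b))%N.
Proof.
rewrite /type2; have [->|g0] := eqVneq g 0; first by rewrite degp0.
rewrite double_degp // (degp_neq0 g) // lte_fin ltz_nat.
have [->|h0] := eqVneq h 0; first by rewrite degp0.
rewrite (degp_neq0 h) // => gh g_gt0 b0; rewrite -size_poly_gt0 in h0.
have {}gh : (2 * (size g).-1)%N = (size h).-1 by case: gh.
have sh : size h = (2 * (size g).-1).+1 by rewrite gh prednK.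
have gt1 : (1 < size h)%N by rewrite sh ltnS muln_gt0.
exact/(leq_trans gt1)/size_quad_norm_even.
Qed.

Theorem theorem4p6 (g h : {poly 'F_2}) (hmin : minimal_rep g h)
    (htype : type1 g h \/ (type2 g h /\ (0%:E < degp g)%E)) :
  forall u : coord_ring g h, is_unit u <-> u = 1.
Proof.
move=> u; split=> [[v uv1]|->]; last by exists 1; rewrite mulr1.
have /= := coord_ring_unit_norm g h u v uv1.
set p := (u : {poly {poly 'F_2}}) => N1.
have p1 : p`_1 = 0.
  apply/eqP/negPn/negP => b0.
  suff : (1 < size (quad_norm _ g h p`_0 p`_1))%N by rewrite N1.
  case: htype => [h1|[h2 g_gt0]]; first exact: size_quad_norm_type1.
  exact: size_quad_norm_type2.
(* With [b = 0] the norm is the square of this coefficient, which is thus a nonzero constant over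
   ['F_2]. *)
have p0 : p`_0 = 1.
  move: N1; rewrite p1 /quad_norm mulr0 expr0n !mul0r subr0 addr0 expr2.
  move/eqP; rewrite size_mul_eq1 => /andP[/eqP s1 _].
  have : p`_0 != 0 by rewrite -size_poly_gt0 s1.
  move/lead_coef_F2; rewrite /lead_coef s1 /= => lc.
  have pE : p`_0 = (p`_0`_0)%:P by apply: size1_polyC; rewrite s1.
  by rewrite pE lc.
apply: val_inj; have := poly_size2E _ p (size_coord _ _ u).
by rewrite p0 p1 mul0r addr0.
Qed.
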